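(* For integers $r\ge 0$ and $n\ge r$, $$d_{n,\lambda}^{(r,Y)}=n!\sum_{l=r}^{n}\binom{l-1}{r-1}\frac{d_{n-l,\lambda}^{Y}}{(n-l)!}.$$
   Context: Let $\lambda$ be a nonzero real number. Set $(x)_{0,\lambda}=1$ and $(x)_{k,\lambda}=x(x-\lambda)\cdots(x-(k-1)\lambda)$ for $k\ge 1$. The degenerate exponential is $e_{\lambda}^{x}(t)=\sum_{k\ge 0}(x)_{k,\lambda}\frac{t^{k}}{k!}$ (so $e_\lambda^x(t)=(1+\lambda t)^{x/\lambda}$ for $t$ near $0$). $Y$ is a real random variable whose moment generating function $E[e^{tY}]=\sum_{n\ge 0}E[Y^n]\frac{t^n}{n!}$ exists for all $t$ in some neighborhood of $0$. $E$ denotes expectation. The probabilistic degenerate derangement numbers associated with $Y$, $d_{n,\lambda}^{Y}$, are defined by $$\frac{1}{1-t}E\big[e_{\lambda}^{-Y}(t)\big]=\sum_{n=0}^{\infty}d_{n,\lambda}^{Y}\frac{t^{n}}{n!}.$$ For an integer $r\ge 0$, the probabilistic degenerate $r$-derangement numbers associated with $Y$, $d_{n,\lambda}^{(r,Y)}$, are defined by $$\frac{t^{r}}{(1-t)^{r+1}}E\big[e_{\lambda}^{-Y}(t)\big]=\sum_{n=0}^{\infty}d_{n,\lambda}^{(r,Y)}\frac{t^{n}}{n!}.$$ (Power series in $t$ near $0$.) Convention: when $r=0$, $\binom{l-1}{-1}$ equals $1$ if $l=0$ and $0$ if $l\ge 1$, so that $\binom{l-1}{r-1}$ is the coefficient of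 $t^l$ in $\left(\frac{t}{1-t}\right)^r$ for all $l\ge r\ge 0$. *)

(* Defs.v *)
From mathcomp Require Import all_boot all_order all_algebra.
From mathcomp Require Import all_classical all_reals all_analysis.
Import Order.TTheory GRing.Theory Num.Theory.
Import numFieldNormedType.Exports.

Set Implicit Arguments.
Unset Strict Implicit.
Unset Printing Implicit Defensive.

Local Open Scope classical_set_scope.
Local Open Scope ring_scope.

(* (x)_{k,lam} = x (x - lam) ... (x - (k-1) lam) *)
Definition dfact (R : realType) (lam x : R) (k : nat) : R :=
  \prod_(i < k) (x - i%:R * lam).

(* The degenerate exponential e_lam^x(t), as the sum of its power series.
   The series converges for |lam * t| < 1, whatever x is; where it diverges the
   value of [lim] is not meaningful. *)
Definition dexp (R : realType) (lam x t : R) : R :=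
  limn (pseries (fun k => dfact lam x k / k`!%:R) t).

(* F(t) = \sum_n a_n t^n / n! for all t in a neighbourhood of 0. F is
   extended-real-valued because expectations are; it has to be finite near 0. *)
Definition is_egf (R : realType) (F : R -> \bar R) (a : nat -> R) : Prop :=
  \forall t \near (0 : R), F t \is a fin_num /\
    pseries (fun n => a n / n`!%:R) t @ \oo --> fine (F t).

(* The sequence a, necessarily unique, such that F(t) = \sum_n a_n t^n / n!
   near 0; the zero sequence if F has no such expansion. *)
Definition egf_coef (R : realType) (F : R -> \bar R) : nat -> R :=
  xget (fun=> 0) [set a | is_egf F a].

Section ProbabilisticDegenerateDerangements.
Context d (T : measurableType d) (R : realType) (P : probability T R).

Definition mgf_exists_near0 (Y : T -> R) : Prop :=
  \forall t \near (0 : R), 'M_P Y t \is a fin_num.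

Definition pd_derangement (lam : R) (Y : T -> R) : nat -> R :=
  egf_coef (fun t =>
    ((1 - t)^-1)%:E * 'E_P[fun w => dexp lam (- Y w) t])%E.

Definition pd_r_derangement (lam : R) (r : nat) (Y : T -> R) : nat -> R :=
  egf_coef (fun t =>
    (t ^+ r / (1 - t) ^+ r.+1)%:E * 'E_P[fun w => dexp lam (- Y w) t])%E.

End ProbabilisticDegenerateDerangements.

(* The binomial coefficient (l-1 choose r-1), used for l >= r only, with
   (l-1 choose -1) equal to 1 if l = 0 and to 0 otherwise. *)
Definition bin_pred (l r : nat) : nat :=
  if r is r'.+1 then 'C(l.-1, r') else (l == 0)%N.

(* Main.v *)
Require Import Defs.
From mathcomp Require Import all_boot all_order all_algebra.
From mathcomp Require Import all_classical all_reals all_analysis.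
From mathcomp Require Import measurable_realfun ring lra.
Import Order.TTheory GRing.Theory Num.Theory.
Import numFieldNormedType.Exports.

(** Write [phi t] for the expectation of the degenerate exponential
    [e_lam^(-Y)(t)]. The generating function of the r-derangement numbers is
    [(t / (1 - t))^r] times that of the derangement numbers, [phi t / (1 - t)],
    and the coefficient of [t^l] in [(t / (1 - t))^r] is [bin_pred l r] for
    [l >= r] and 0 for [l < r]; the identity is the resulting Cauchy product. Everything is done with ordinary
    power series coefficients. Multiplying by [1 / (1 - t)] replaces a
    coefficient sequence by its partial sums ([pseries_partial_sums]), and
    multiplying by [t^r] shifts it ([pseries_shifted]). Taking partial sums [r]
    times is convolution with the coefficients of [(1 - t)^-r], by Pascal's rule
    ([iter_partial_sumsE]).

    The numbers in question are defined by choice, as the coefficients of an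
    expansion if there is one, so two analytic facts are needed. The first is
    uniqueness of the coefficients ([is_egf_unique]). The second is that [phi]
    does have a power series expansion near 0
    ([is_egf_expectation_dexp]); without it the choice could return the zero
    sequence. For the expansion, the [k]-th term of the series of
    [e_lam^(-Y)(t)] is at most [2^-k * exp (4 |t| |Y|)] once [4 |lam t| <= 1]
    ([dfact_term_bound]). The partial sums are then dominated by
    [2 * exp (4 |t| |Y|)], which is integrable for small [t] because the moment
    generating function of [Y] is finite near 0, and dominated convergence
    exchanges the expectation with the sum. *)

Set Implicit Arguments.
Unset Strict Implicit.
Unset Printing Implicit Defensive.

Local Open Scope classical_set_scope.
Local Open Scope ring_scope.

(** * Operations on convergent power series *)

Section PowerSeries.
Context {R : realType}.
Implicit Types (a : nat -> R) (t l : R).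

Definition partial_sums a n : R := \sum_(k < n.+1) a k.

(** The coefficients of [t^r] times the power series of [a]. *)
Definition shifted r a n : R := if (n < r)%N then 0 else a (n - r)%N.

Lemma pseries_ordE a t n : pseries a t n = \sum_(k < n) a k * t ^+ k.
Proof. by rewrite /pseries /series /= big_mkord. Qed.

Lemma pseries_coef_bound a t : cvgn (pseries a t) ->
  exists2 C, 0 < C & forall n, `|a n| * `|t| ^+ n <= C.
Proof.
move=> /cvg_series_cvg_0 h.
have /cvg_seq_bounded := cvgP _ h.
case/pinfty_ex_gt0 => C C0 hC; exists C => //.
by move=> n; rewrite -normrX -normrM; exact: hC.
Qed.

(** Since [(1 - t) * \sum_(k < n) A_k t^k] telescopes to
    [\sum_(k < n) a_k t^k - A_(n-1) t^n], with [A] the partial sums of [a], the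
    point is that the remainder vanishes in the limit. Convergence at [s] makes
    [a_k s^k] bounded, and [s <= 1/2] makes [A_(n-1)] grow no faster than
    [s^-n], whence the restriction to [|t| < s]. *)
Lemma pseries_partial_sums a s t l : 0 < s <= 2^-1 -> `|t| < s ->
  cvgn (pseries a s) -> pseries a t @ \oo --> l ->
  pseries (partial_sums a) t @ \oo --> l / (1 - t).
Proof.
move=> /andP[s0 s2] ts cvs cvt.
have [C C0 hC] := pseries_coef_bound cvs.
have t1 : 1 - t != 0.
  by rewrite subr_eq0 eq_sym; apply: contraTneq ts => ->; rewrite normr1; lra.
pose A n := \sum_(k < n) a k.
have Abound n : `|A n| * s ^+ n <= C.
  elim: n => [|n IH]; first by rewrite /A big_ord0 normr0 mul0r ltW.
  have := hC n; rewrite /A big_ord_recr/= -/(A n) (gtr0_norm s0) => an.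
  have sn : 0 < s ^+ n by rewrite exprn_gt0.
  (* The bound C reproduces itself because (C + C) * s <= C. *)
  rewrite exprSr mulrA; apply: (@le_trans _ _ ((C + C) * s)); last by nra.
  rewrite ler_pM2r//; apply: le_trans (lerD IH an).
  by rewrite -mulrDl ler_pM2r// ler_normD.
have rest : (fun n => A n * t ^+ n) @ \oo --> 0.
  apply/cvgr0Pnorm_le => e e0.
  have q0 : 0 <= `|t| / s by rewrite divr_ge0// ltW.
  have q1 : `| `|t| / s | < 1 by rewrite ger0_norm// ltr_pdivrMr// mul1r.
  have /cvgr0Pnorm_le/(_ _ (divr_gt0 e0 C0)) := cvg_expr q1.
  apply: filterS => n; rewrite ger0_norm ?exprn_ge0// normrM normrX.
  have sn : 0 < s ^+ n by rewrite exprn_gt0.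
  rewrite expr_div_n ler_pdivrMr// mulrAC ler_pdivlMr// => h.
  rewrite -(ler_pM2r sn) (le_trans _ h)// mulrAC mulrC.
  by rewrite ler_wpM2l// exprn_ge0.
have -> : pseries (partial_sums a) t =
    (fun n => (pseries a t n - A n * t ^+ n) / (1 - t)).
  apply/funext => n; apply/(canRL (mulfK t1)); rewrite !pseries_ordE.
  elim: n => [|n IH]; first by rewrite /A !big_ord0 !mul0r subr0.
  rewrite !big_ord_recr/= mulrDl IH /A /partial_sums !big_ord_recr/= exprSr.
  ring.
rewrite -[l]subr0; apply: cvgM; last exact: cvg_cst.
exact: cvgB.
Qed.

Lemma pseries_shifted r a t l : pseries a t @ \oo --> l ->
  pseries (shifted r a) t @ \oo --> t ^+ r * l.
Proof.
move=> cvt.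
rewrite -(@cvg_shiftn r) /=.
under eq_fun => n.
  rewrite addnC pseries_ordE big_split_ord/= big1 ?add0r; last first.
    by move=> i _; rewrite /shifted/= ltn_ord mul0r.
  under eq_bigr => i _.
    rewrite /shifted ltnNge leq_addr/= addKn exprD mulrCA.
    over.
  rewrite -big_distrr/= -pseries_ordE.
  over.
by apply: cvgM => //; exact: cvg_cst.
Qed.

(** Convergence at some [s] bounds the tail [|pseries a (q s) - a 0|] by
    [2 C q] for [q <= 1/2]. With the sum equal to 0 for arbitrarily small [q],
    this forces [a 0 = 0]. *)
Lemma pseries_zero_head a e : 0 < e ->
  (forall t, 0 < t < e -> pseries a t @ \oo --> 0) -> a 0%N = 0.
Proof.
move=> e0 H; apply: contrapT => /eqP a0.
pose s := e / 2.
have s0 : 0 < s by rewrite divr_gt0.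
have se : s < e by rewrite ltr_pdivrMr// mulr_natr mulr2n ltrDl.
case: (@pseries_coef_bound a s)=> [|C C0 hC].
  by apply: (cvgP 0); apply: H; rewrite s0.
(* With this q, the tail bound 2 C q is at most half of |a 0|. *)
pose q := Num.min 2^-1 (`|a 0%N| / (4 * C)).
have q0 : 0 < q by rewrite lt_min invr_gt0 ltr0n/= divr_gt0 ?normr_gt0// mulr_gt0.
have q2 : q <= 2^-1 by rewrite ge_min lexx.
have qC : q * (4 * C) <= `|a 0%N|.
  by rewrite -ler_pdivlMr ?mulr_gt0// ge_min lexx orbT.
have qs : 0 < q * s < e.
  rewrite mulr_gt0//=; apply: le_lt_trans se.
  by rewrite ler_piMl ?(ltW s0)// (le_trans q2)// invf_le1// ler1n.
have bound n : `|pseries a (q * s) n.+1 - a 0%N| <= C * (2 * q - 2 * q ^+ n.+1).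
  rewrite pseries_ordE big_ord_recl expr0 mulr1 addrAC subrr add0r.
  elim: n => [|n IH]; first by rewrite big_ord0 normr0 expr1 subrr mulr0.
  rewrite big_ord_recr/=; apply: le_trans (ler_normD _ _) _.
  have := hC n.+1; rewrite (gtr0_norm s0) /bump/= add1n => an.
  have qn : 0 < q ^+ n.+1 by rewrite exprn_gt0.
  have {}an : `|a n.+1 * (q * s) ^+ n.+1| <= C * q ^+ n.+1.
    rewrite normrM exprMn normrM (gtr0_norm qn) mulrCA mulrC.
    by rewrite ler_pM2r// (gtr0_norm (exprn_gt0 _ s0)).
  apply: le_trans (lerD IH an) _.
  have : 0 <= C * q ^+ n.+1 * (1 - 2 * q).
    by rewrite mulr_ge0 ?mulr_ge0 ?(ltW C0) ?(ltW qn)//; lra.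
  rewrite (exprS q n.+1); lra.
have h : `|0 - a 0%N| <= C * (2 * q).
  apply: (@cvgr_to_le _ (\oo : set_system nat) _ _
    (fun n => `|pseries a (q * s) n.+1 - a 0%N|)).
    apply: cvg_norm; apply: cvgB; last exact: cvg_cst.
    by rewrite (@cvg_shiftS _ (pseries a (q * s))); exact: H.
  apply: nearW => n; apply: le_trans (bound n) _.
  by rewrite ler_pM2l// gerBl mulr_ge0// exprn_ge0// ltW.
have : 0 < `|a 0%N| by rewrite normr_gt0.
rewrite sub0r normrN in h; nra.
Qed.

(** The head vanishes, and dividing by [t] yields a series with the shifted
    coefficients that satisfies the same hypothesis; this is why only [t > 0]
    is asked for. *)
Lemma pseries_eq0 a e : 0 < e ->
  (forall t, 0 < t < e -> pseries a t @ \oo --> 0) -> forall n, a n = 0.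
Proof.
move=> e0 H n; elim: n a H => [|n IH] a H; first exact: (pseries_zero_head e0 H).
apply: (IH (fun k => a k.+1)) => t te.
have t0 : t != 0 by rewrite gt_eqF//; case/andP: te.
have -> : pseries (fun k => a k.+1) t = fun n => pseries a t n.+1 / t.
  apply/funext => m; apply/(canRL (mulfK t0)).
  rewrite !pseries_ordE big_ord_recl (pseries_zero_head e0 H) mul0r add0r big_distrl/=.
  by apply: eq_bigr => i _; rewrite /bump/= add1n exprSr mulrA.
rewrite -(mul0r t^-1); apply: cvgM; last exact: cvg_cst.
by rewrite (@cvg_shiftS _ (pseries a t)); exact: H.
Qed.

End PowerSeries.

(** * Germs at 0 and exponential generating functions *)

Section Germs.
Context {R : realType}.
Implicit Types (a b : nat -> R) (f : R -> R) (F : R -> \bar R).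

Lemma near_pseries_partial_sums a f :
  (\forall t \near 0, pseries a t @ \oo --> f t) ->
  \forall t \near 0, pseries (partial_sums a) t @ \oo --> f t / (1 - t).
Proof.
case/nbhs_ballP => /= e e0 He; pose s := Num.min (e / 2) 2^-1.
have s0 : 0 < s by rewrite lt_min divr_gt0/= ?invr_gt0.
have se : s < e.
  apply: (@le_lt_trans _ _ (e / 2)); rewrite ?ge_min ?lexx//.
  by rewrite ltr_pdivrMr// mulr_natr mulr2n ltrDl.
apply/nbhs_ballP; exists s => //= t; rewrite /ball/= sub0r normrN => ts.
apply: (@pseries_partial_sums _ _ s) => //.
- by rewrite s0 ge_min lexx orbT.
- by apply: cvgP; apply: He; rewrite /ball/= sub0r normrN gtr0_norm.
- by apply: He; rewrite /ball/= sub0r normrN (lt_trans ts).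
Qed.

Lemma near_pseries_iter_partial_sums r a f :
  (\forall t \near 0, pseries a t @ \oo --> f t) ->
  \forall t \near 0,
    pseries (iter r partial_sums a) t @ \oo --> f t / (1 - t) ^+ r.
Proof.
move=> af; elim: r => [|r IH].
  by apply: filterS af => t; rewrite expr0 divr1.
apply: filterS (near_pseries_partial_sums IH) => t.
by rewrite exprSr invfM mulrA.
Qed.

(** [bin_pred (l + r) r] is the coefficient of [t^l] in [(1 - t)^-r], so this
    is the Cauchy product with [(1 - t)^-r]. Both sides satisfy
    [u (r+1) (n+1) = u (r+1) n + u r (n+1)], the right-hand one by Pascal's
    rule. *)
Lemma iter_partial_sumsE r a n : iter r partial_sums a n =
  \sum_(l < n.+1) (bin_pred (l + r) r)%:R * a (n - l)%N.
Proof.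
elim: r n => [|r IHr] n.
  rewrite big_ord_recl /= subn0 mul1r big1 ?addr0// => i _.
  by rewrite mul0r.
elim: n => [|n IHn].
  rewrite iterS /partial_sums !big_ord_recl !big_ord0 IHr.
  rewrite big_ord_recl big_ord0 !addr0; congr (_%:R * _).
  by case: r {IHr} => //= r; rewrite ?add0n !binn.
rewrite iterS /partial_sums big_ord_recr/= -/(partial_sums _ n) -iterS IHn IHr.
rewrite [X in _ + X]big_ord_recl [RHS]big_ord_recl addrCA -big_split/=.
congr (_%:R * _ + _).
  by case: r {IHr IHn} => //= r; rewrite ?add0n !binn.
apply: eq_bigr => i _; rewrite /bump/= add1n subSS -mulrDl -natrD.
congr (_%:R * _); case: r {IHr IHn} => [|r]/=.
  by rewrite !bin0 addn0.
by rewrite add0n !addnS/= [RHS]binS.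
Qed.

Lemma is_egf_unique F a b : is_egf F a -> is_egf F b -> a = b.
Proof.
move=> /nbhs_ballP[e /= e0 Ha] /nbhs_ballP[e' /= e'0 Hb].
have m0 : 0 < Num.min e e' by rewrite lt_min e0.
have coef0 n : a n / n`!%:R - b n / n`!%:R = 0.
  apply: (@pseries_eq0 _ (fun n => a n / n`!%:R - b n / n`!%:R) _ m0) => t.
  rewrite lt_min => /and3P[t0 te te'].
  have [_ ta] : F t \is a fin_num /\
      pseries (fun n => a n / n`!%:R) t @ \oo --> fine (F t).
    by apply: Ha; rewrite /ball/= sub0r normrN gtr0_norm.
  have [_ tb] : F t \is a fin_num /\
      pseries (fun n => b n / n`!%:R) t @ \oo --> fine (F t).
    by apply: Hb; rewrite /ball/= sub0r normrN gtr0_norm.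
  rewrite -(subrr (fine (F t))).
  rewrite (_ : pseries _ t =
    pseries (fun n => a n / n`!%:R) t \- pseries (fun n => b n / n`!%:R) t).
    exact: cvgB.
  apply/funext => m; rewrite /= !pseries_ordE -sumrB.
  by apply: eq_bigr => k _; rewrite mulrBl.
apply/funext => n; apply/eqP; rewrite -subr_eq0; move/eqP: (coef0 n).
by rewrite -mulrBl mulf_eq0 invr_eq0 pnatr_eq0 (gtn_eqF (fact_gt0 n)) orbF.
Qed.

Lemma egf_coefE F a : is_egf F a -> egf_coef F = a.
Proof.
by move=> Fa; apply: (is_egf_unique _ Fa); apply: xgetPex; exists a.
Qed.

End Germs.

(** * Bounds on the degenerate exponential *)

Section DegenerateExponential.
Context {R : realType}.
Implicit Types (x y t lam : R).

Lemma exprn_fact_le_expR x n : 0 <= x -> x ^+ n / n`!%:R <= expR x.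
Proof.
move=> x0; case: n => [|n].
  by rewrite expr0 fact0 divr1 (le_trans _ (expR_ge1Dx x))// lerDl.
by apply: le_trans (expR_ge1Dxn n x0); rewrite lerDr.
Qed.

(** Passing from [k] to [k+1] multiplies the left-hand side by
    [(x + k / 2) / (k + 1)]. For [k > 2 x] this factor is at most 1, so the bound
    persists; for [k <= 2 x] all the factors [x + i / 2] are at most [2 x], and
    [(2 x)^(k+1) / (k+1)!] is a single term of the series of [exp (2 x)]. *)
Lemma half_rising_fact_le_expR x k : 0 <= x ->
  (\prod_(i < k) (x + i%:R / 2)) / k`!%:R <= expR (2 * x).
Proof.
move=> x0; elim: k => [|k IH].
  by rewrite big_ord0 (le_trans _ (exprn_fact_le_expR 0 _))// mulr_ge0.
have [k_small|k_large] := leP k%:R (2 * x).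
  apply: le_trans (exprn_fact_le_expR k.+1 (mulr_ge0 _ x0)) => //.
  rewrite ler_pM2r ?invr_gt0 ?ltr0n ?fact_gt0//.
  rewrite -[X in _ <= _ ^+ X]card_ord -prodr_const.
  apply: ler_prod => i _; rewrite addr_ge0 ?divr_ge0//=.
  have : i%:R <= k%:R :> R by rewrite ler_nat -ltnS.
  lra.
apply: le_trans IH.
have k0 : 0 < k`!%:R :> R by rewrite ltr0n fact_gt0.
have p0 : 0 <= \prod_(i < k) (x + i%:R / 2).
  by apply: prodr_ge0 => i _; rewrite addr_ge0 ?divr_ge0.
rewrite big_ord_recr/= factS mulnC natrM invfM mulrACA ler_piMr//.
  by rewrite divr_ge0// ltW.
by rewrite ler_pdivrMr ?ltr0n// mul1r -(natr1 k); lra.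
Qed.

(** Each factor [|(y - i lam) t|] is at most
    [|t y| + i / 4 = 2^-1 * (2 |t y| + i / 2)], which is where the rising product
    with step 1/2 and the geometric factor come from. The bound serves both for
    the convergence of the series and for its domination by an integrable
    function of [y]. *)
Lemma dfact_term_bound lam y t k : 4 * `|lam * t| <= 1 ->
  `|dfact lam y k / k`!%:R * t ^+ k| <= 2^-1 ^+ k * expR (4 * `|t| * `|y|).
Proof.
move=> lamt.
have -> : 4 * `|t| * `|y| = 2 * (2 * `|t * y|) by rewrite normrM; ring.
have X0 : 0 <= 2 * `|t * y| by rewrite mulr_ge0.
have fk : 0 < k`!%:R :> R by rewrite ltr0n fact_gt0.
apply: le_trans (ler_wpM2l _ (half_rising_fact_le_expR k X0)); last first.
  by rewrite exprn_ge0// invr_ge0.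
rewrite mulrAC normrM normfV (gtr0_norm fk) mulrA ler_pM2r ?invr_gt0//.
rewrite -[in t ^+ _](card_ord k) -[in 2^-1 ^+ _](card_ord k) -!prodr_const.
rewrite /dfact -!big_split/= normr_prod; apply: ler_prod => i _.
rewrite normr_ge0/= mulrBl (le_trans (ler_normB _ _))//.
have -> : i%:R * lam * t = i%:R * (lam * t) by rewrite mulrA.
rewrite [y * t]mulrC (normrM i%:R) normr_nat.
have : i%:R * (4 * `|lam * t|) <= i%:R :> R by rewrite ler_piMr.
lra.
Qed.

Lemma partial_geometric_half n : \sum_(k < n) 2^-1 ^+ k <= 2 :> R.
Proof.
suff -> : \sum_(k < n) 2^-1 ^+ k = 2 - 2 * 2^-1 ^+ n :> R.
  by rewrite gerBl mulr_ge0// exprn_ge0// invr_ge0.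
elim: n => [|n IH]; first by rewrite big_ord0 expr0; ring.
by rewrite big_ord_recr/= IH exprS; field.
Qed.

Lemma dexp_cvg lam y t : 4 * `|lam * t| <= 1 ->
  pseries (fun k => dfact lam y k / k`!%:R) t @ \oo --> dexp lam y t.
Proof.
move=> lamt; apply: normed_cvg.
apply: (@series_le_cvg _ _ (geometric (expR (4 * `|t| * `|y|)) 2^-1)) => //= [n|].
- by rewrite [leRHS]mulrC; exact: dfact_term_bound.
- by apply: is_cvg_geometric_series; rewrite ger0_norm ?invr_ge0// invf_lt1// ltr1n.
Qed.

Lemma pseries_dfact_bound lam y t n : 4 * `|lam * t| <= 1 ->
  `|pseries (fun k => dfact lam y k / k`!%:R) t n| <=
    2 * expR (4 * `|t| * `|y|).
Proof.
move=> lamt; rewrite /pseries /series/= big_mkord.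
apply: le_trans (ler_norm_sum _ _ _) _.
apply: (@le_trans _ _ (\sum_(k < n) 2^-1 ^+ k * expR (4 * `|t| * `|y|))).
  by apply: ler_sum => k _; exact: dfact_term_bound.
by rewrite -big_distrl/= ler_pM2r ?expR_gt0// partial_geometric_half.
Qed.

End DegenerateExponential.

(** * Expectation of the degenerate exponential *)

Section ExpectationOfDegenerateExponential.
Context {d : measure_display} {T : measurableType d} {R : realType}.
Context (P : probability T R) (Y : {RV P >-> R}).

Lemma integrable_expR_scale (c : R) : 'M_P Y c \is a fin_num ->
  P.-integrable setT (fun w => (expR (c * Y w))%:E).
Proof.
rewrite /mmt_gen_fun unlock /= => Mc; apply/integrableP; split.
  apply/measurable_EFinP; apply: measurableT_comp => //.
  exact: measurable_funM.
rewrite (eq_integral (fun w => (expR (Y w * c))%:E)); last first.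
  by move=> w _; rewrite /= ger0_norm ?expR_ge0// mulrC.
by rewrite ltey_eq Mc.
Qed.

(** [exp (c |Y|)] is one of [exp (c Y)], [exp (- c Y)], hence at most their
    sum. *)
Lemma integrable_expR_abs (c : R) :
  'M_P Y c \is a fin_num -> 'M_P Y (- c) \is a fin_num ->
  P.-integrable setT (fun w => (expR (c * `|Y w|))%:E).
Proof.
move=> /integrable_expR_scale iM /integrable_expR_scale iMN.
have := integrableD measurableT iM iMN; apply: le_integrable => //.
  apply/measurable_EFinP; apply: measurableT_comp => //.
  apply: measurable_funM => //; exact: measurableT_comp.
move=> w _; rewrite /= lee_fin (ger0_norm (expR_ge0 _)).
rewrite (ger0_norm (addr_ge0 (expR_ge0 _) (expR_ge0 _))).
have [Y0|/ltW Y0] := leP 0 (Y w); first by rewrite ger0_norm// lerDl expR_ge0.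
by rewrite ler0_norm// mulrN mulNr lerDr expR_ge0.
Qed.

Lemma measurable_dfact (lam : R) k :
  measurable_fun setT (fun w => dfact lam (- Y w) k).
Proof.
apply: measurable_prod => i _; apply: measurable_funB => //.
exact: measurableT_comp.
Qed.

(** Dominated convergence, applied to the partial sums of the series of
    [e_lam^(-Y)(t)]. The same bound, read for a single term, gives the
    integrability of each [dfact lam (-Y) k]. *)
Lemma is_egf_expectation_dexp (lam : R) : mgf_exists_near0 P Y ->
  is_egf (fun t => 'E_P[fun w => dexp lam (- Y w) t])%E
    (fun k => fine 'E_P[fun w => dfact lam (- Y w) k])%E.
Proof.
case/nbhs_ballP => /= e e0 He.
(* 4 * s < e, so that the moment generating function is finite at 4 * s and
   - 4 * s; the second bound gives 4 * |lam * s| <= 1, and + 1 keeps the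
   denominator positive. *)
pose s := Num.min (e / 8) (4 * (`|lam| + 1))^-1.
have s0 : 0 < s.
  by rewrite lt_min divr_gt0//= invr_gt0 mulr_gt0// ltr_wpDl.
have s_e : 4 * s < e.
  have : s <= e / 8 by rewrite ge_min lexx.
  have : 0 < e by [].
  lra.
have s_lam : 4 * `|lam * s| <= 1.
  have : s <= (4 * (`|lam| + 1))^-1 by rewrite ge_min lexx orbT.
  have L : 0 < 4 * (`|lam| + 1) by rewrite mulr_gt0// ltr_wpDl.
  rewrite -[leRHS]mul1r ler_pdivlMr// normrM (gtr0_norm s0).
  lra.
have ig : P.-integrable setT (fun w => (expR (4 * s * `|Y w|))%:E).
  apply: integrable_expR_abs; apply: He; rewrite /ball/= sub0r !normrN;
    by rewrite gtr0_norm// mulr_gt0.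
have idfact k : P.-integrable setT (fun w => (dfact lam (- Y w) k)%:E).
  have := integrableZl measurableT (k`!%:R / s ^+ k) ig.
  apply: le_integrable => //.
    by apply/measurable_EFinP; exact: measurable_dfact.
  move=> w _; rewrite /= lee_fin.
  have fk : 0 < k`!%:R :> R by rewrite ltr0n fact_gt0.
  have sk : 0 < s ^+ k by rewrite exprn_gt0.
  have := dfact_term_bound (- Y w) k s_lam; rewrite normrN (gtr0_norm s0).
  set E := expR _ => h.
  have {}h : `|dfact lam (- Y w) k / k`!%:R * s ^+ k| <= E.
    apply: le_trans h _; rewrite ler_piMl ?expR_ge0//.
    by rewrite exprn_ile1 ?invr_ge0// invf_le1// ler1n.
  rewrite [leRHS]ger0_norm; last by rewrite mulr_ge0 ?expR_ge0// divr_ge0// ltW.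
  move: h; rewrite !normrM normfV (gtr0_norm fk) (gtr0_norm sk) => h.
  have -> : `|dfact lam (- Y w) k| =
      k`!%:R / s ^+ k * (`|dfact lam (- Y w) k| / k`!%:R * s ^+ k).
    by field; rewrite !gt_eqF.
  by rewrite ler_wpM2l// divr_ge0// ltW.
apply/nbhs_ballP; exists s => //= t; rewrite /ball/= sub0r normrN => ts.
have t_lam : 4 * `|lam * t| <= 1.
  apply: le_trans s_lam; rewrite !normrM ler_pM2l//.
  by rewrite ler_wpM2l// (le_trans (ltW ts))// ler_norm.
set p := fun w => pseries (fun k => dfact lam (- Y w) k / k`!%:R) t.
have mp n : measurable_fun setT (p^~ n).
  rewrite /p/pseries/series/=.
  apply: measurable_sum => k; apply: measurable_funM => //.
  apply: measurable_funM => //; exact: measurable_dfact.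
have p_cvg w : p w n @[n --> \oo] --> dexp lam (- Y w) t by exact: dexp_cvg.
have mdexp : measurable_fun setT (fun w => dexp lam (- Y w) t).
  by apply: (measurable_fun_cvg mp) => w _; exact: p_cvg.
have [] := @dominated_convergence _ _ _ P setT measurableT
  (fun n w => (p w n)%:E) (fun w => (dexp lam (- Y w) t)%:E)
  (fun w => 2%:E * (expR (4 * s * `|Y w|))%:E)%E.
- by move=> n; exact/measurable_EFinP.
- exact/measurable_EFinP.
- by apply: aeW => w _; apply: cvg_EFin; [exact: nearW | exact: p_cvg].
- exact: integrableZl.
- apply: aeW => w n _; rewrite /= lee_fin.
  apply: le_trans (pseries_dfact_bound _ _ t_lam) _.
  rewrite ler_pM2l// ler_expR normrN.
  by rewrite ler_wpM2r// ler_wpM2l// ltW.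
move=> idexp _ cvgp; rewrite unlock; split; first exact: integrable_fin_num.
have -> : pseries (fun k => fine (\int[P]_w (dfact lam (- Y w) k)%:E) / k`!%:R) t
   = fun n => fine (\int[P]_w (p w n)%:E).
  apply/funext => n; rewrite pseries_ordE.
  have -> : (fun w => (p w n)%:E) = fun w => (\sum_(k < n)
      (t ^+ k / k`!%:R)%:E * (dfact lam (- Y w) k)%:E)%E.
    apply/funext => w; rewrite /p pseries_ordE -sumEFin; apply: eq_bigr => k _.
    by rewrite -EFinM; congr EFin; ring.
  rewrite integral_sum//; last by move=> k; exact: integrableZl.
  rewrite -sum_fine; last first.
    by move=> k _; apply: integrable_fin_num => //; exact: integrableZl.
  apply: eq_bigr => k _; rewrite integralZl// fineM ?integrable_fin_num//=; ring.
by apply: fine_cvg; rewrite fineK ?integrable_fin_num.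
Qed.

End ExpectationOfDegenerateExponential.

(** * The recurrence between the derangement numbers *)

Theorem theorem2p8 (d : measure_display) (T : measurableType d) (R : realType)
    (P : probability T R) (Y : {RV P >-> R}) (lam : R) (r n : nat) :
  lam != 0 ->
  mgf_exists_near0 P Y ->
  (r <= n)%N ->
  pd_r_derangement P lam r Y n =
  n`!%:R * \sum_(r <= l < n.+1)
    ((bin_pred l r)%:R * (pd_derangement P lam Y (n - l)%N / (n - l)`!%:R)).
Proof.
move=> _ mgfY rn.
pose phi t := ('E_P[fun w => dexp lam (- Y w) t])%E.
pose c k : R := fine ('E_P[fun w => dfact lam (- Y w) k])%E / k`!%:R.
have phi_c : \forall t \near 0, phi t \is a fin_num /\
    pseries c t @ \oo --> fine (phi t) := is_egf_expectation_dexp lam mgfY.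
have c_phi : \forall t \near 0, pseries c t @ \oo --> fine (phi t).
  by apply: filterS phi_c => t [].
have factK (x : R) k : k`!%:R * x / k`!%:R = x.
  by rewrite mulrAC mulfV ?mul1r// pnatr_eq0 (gtn_eqF (fact_gt0 k)).
have dE k : pd_derangement P lam Y k / k`!%:R = partial_sums c k.
  rewrite /pd_derangement (egf_coefE (a := fun k => k`!%:R * partial_sums c k)).
    exact: factK.
  apply: filterS2 phi_c (near_pseries_partial_sums c_phi) => t [phi_fin _] h.
  split; first by rewrite fin_numM.
  rewrite fineM//= mulrC; under eq_fun do rewrite factK.
  exact: h.
have -> : pd_r_derangement P lam r Y =
    fun k => k`!%:R * shifted r (iter r partial_sums (partial_sums c)) k.
  apply: egf_coefE.
  have := near_pseries_iter_partial_sums r (near_pseries_partial_sums c_phi).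
  apply: filterS2 phi_c => t [phi_fin _] h.
  split; first by rewrite fin_numM.
  under eq_fun do rewrite factK.
  rewrite fineM//= (_ : _ * fine _ = t ^+ r * (fine (phi t) / (1 - t) / (1 - t) ^+ r)).
    exact: pseries_shifted h.
  by rewrite exprS invfM /phi; ring.
rewrite /shifted ltnNge rn /= iter_partial_sumsE; congr (_ * _).
rewrite -[X in index_iota X _]add0n big_addn big_mkord subSn//.
by apply: eq_bigr => l _; rewrite dE subnDA subnAC.
Qed.
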